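(* Let $\Omega$ be a bounded domain with boundary $\Gamma=\Gamma_u\cup\Gamma_t$, $\Gamma_u\cap\Gamma_t=\emptyset$, where the displacements $\bar{\bm{u}}$ are prescribed along $\Gamma_u$ and the surface tractions $\bar{\bm{t}}$ are given along $\Gamma_t$, and let $\bm{f}$ be the body force in $\Omega$. The stationary points of the Lagrangian $$\mathcal{L}(\bm{\sigma},\bm{u},\bm{\omega};\bm{f},\bar{\bm{u}})=\frac12\int_\Omega \bm{\sigma}^T\bm{C}\bm{\sigma}\,\mathrm{d}\Omega-\int_{\Gamma_u}\bm{t}^T\bar{\bm{u}}\,\mathrm{d}\Gamma+\int_\Omega \bm{u}^T\left(\bm{D}\bm{\sigma}+\bm{f}\right)\mathrm{d}\Omega-\int_\Omega\bm{\omega}^T\bm{R}\bm{\sigma}\,\mathrm{d}\Omega$$ solve the linear elastic problem consisting of the equilibrium equations $$\frac{\partial}{\partial x_i}\sigma_{ij}+f_j=0\ \text{ in }\Omega,\qquad \sigma_{ij}-\sigma_{ji}=0\ \text{ in }\Omega,\qquad \sigma_{ij}n_i=\bar t_j\ \text{ along }\Gamma_t,$$ and the constitutive equations $$\varepsilon_{ij}=C_{ijkl}\,\sigma_{kl},\qquad\text{where}\quad \varepsilon_{ij}=\frac12\left(\frac{\partial u_i}{\partial x_j}+\frac{\partial u_j}{\partial x_i}\right).$$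
   Context: Setting: linear elastostatics in Cartesian coordinates $(x_1,x_2,x_3)$, Einstein summation over repeated indices in $\{1,2,3\}$. $n_i$ are the components of the unit normal vector along the boundary, and $\bm{t}$ is the surface traction of the stress field, $t_j=\sigma_{ij}n_i$. The tractions on $\Gamma_t$ are prescribed data, so variations of the stress field have zero traction on $\Gamma_t$. The stress has nine components (symmetry is not assumed a priori), arranged as $$\bm{\sigma}=(\sigma_{11},\sigma_{21},\sigma_{31},\sigma_{12},\sigma_{22},\sigma_{32},\sigma_{13},\sigma_{23},\sigma_{33})^T,$$ and the strain vector $\bm{\varepsilon}$ is arranged in the same order. $C_{ijkl}$ is the compliance tensor of the linear elastic material and $\bm{C}$ is its matrix in this ordering, so that $\bm{\varepsilon}=\bm{C}\bm{\sigma}$ means $\varepsilon_{ij}=C_{ijkl}\sigma_{kl}$. $\bm{D}$ is the divergence matrix, $(\bm{D}\bm{\sigma})_j=\frac{\partial}{\partial x_i}\sigma_{ij}$, and $$\bm{R}=\begin{bmatrix}0&0&0&0&0&1&0&-1&0\\0&0&1&0&0&0&-1&0&0\\0&1&0&-1&0&0&0&0&0\end{bmatrix},$$ so that $-\bm{R}\bm{\sigma}=0$ expresses equilibrium of moments $\sigma_{ij}=\sigma_{ji}$. The displacement field $\bm{u}=(u_1,u_2,u_3)^T$ and the rotation field $\bm{\omega}=(\omega_1,\omega_2,\omega_3)^T=(\omega_{23},\omega_{13},\omega_{12})^T$ are the Lagrange multipliers that enforce equilibrium of forces and equilibrium of moments, respectively, in the minimization of the complementary energy $\frac12\int_\Omega\bm{\sigma}^T\bm{C}\bm{\sigma}\,\mathrm{d}\Omega-\int_{\Gamma_u}\bm{t}^T\bar{\bm{u}}\,\mathrm{d}\Gamma$.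 With the rotation components $\omega_{ij}=\frac12\left(\frac{\partial u_j}{\partial x_i}-\frac{\partial u_i}{\partial x_j}\right)$, the strain satisfies $\varepsilon_{ij}=\frac{\partial u_j}{\partial x_i}-\omega_{ij}$; in vector form $\bm{\varepsilon}=\bm{D}^T\bm{u}+\bm{R}^T\bm{\omega}$, where $\bm{D}^T$ is the gradient matrix (the entry of $\bm{D}^T\bm{u}$ in the position of $\sigma_{ij}$ is $\frac{\partial u_j}{\partial x_i}$, without minus sign). A stationary point is a triple $(\bm{\sigma},\bm{u},\bm{\omega})$ at which the variations of $\mathcal{L}$ with respect to $\bm{\sigma}$, $\bm{u}$ and $\bm{\omega}$ vanish. *)

(* Defs.v *)
From HB Require Import structures.
From mathcomp Require Import all_boot all_order all_algebra.
From mathcomp Require Import all_classical all_reals all_analysis.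
Set Implicit Arguments.
Unset Strict Implicit.
Unset Printing Implicit Defensive.
Import Order.TTheory GRing.Theory Num.Theory.
Import numFieldNormedType.Exports.

Local Open Scope classical_set_scope.
Local Open Scope ring_scope.

(* Points of Euclidean 3-space are row vectors, values of vector fields are
   column vectors, and values of tensor fields are 3 x 3 matrices whose entry
   (i, j) is the ij component.  Indices run over 'I_3 = {0, 1, 2}, so they are
   one less than the customary 1, 2, 3. *)

Section Euclidean.
Variable R : realType.
Local Notation E := 'rV[R]_3.
Implicit Types (x y n : E) (A Omega : set E).

Definition dotp x y : R := \sum_i x 0 i * y 0 i.

(* The library's `|x| on 'rV[R]_3 is the maximum norm.  It gives the right
   topology, but lengths have to be measured with the Euclidean norm. *)
Definition enorm x : R := Num.sqrt (dotp x x).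

Definition boundary A : set E := closure A `\` interior A.

(* n is the outward unit normal of Omega at x: at small scale Omega lies
   between every pair of cones around the half space {y | (y - x).n < 0}.
   Such an n is unique.  It exists on smooth faces and at almost every
   boundary point of a Lipschitz domain, but not on edges and corners. *)
Definition outward_normal Omega x n : Prop :=
  [/\ boundary Omega x, enorm n = 1 &
    forall e : R, 0 < e -> exists2 d : R, 0 < d &
      forall y, enorm (y - x) < d ->
        (dotp (y - x) n < - (e * enorm (y - x)) -> Omega y) /\
        (e * enorm (y - x) < dotp (y - x) n -> ~ closure Omega y)].

(* Equal to 0 where there is no normal. *)
Definition normal Omega x : E := xget 0 (outward_normal Omega x).

Definition diameter A : \bar R :=
  ereal_sup (0%E |` [set (enorm (p.1 - p.2))%:E | p in A `*` A]).

End Euclidean.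

Section Hausdorff.
Variable R : realType.
Local Notation E := 'rV[R]_3.
Implicit Types (A B : set E) (d : R).
Local Open Scope ereal_scope.

Definition small_cover d A : set ((set E)^nat) :=
  [set U | (forall k, diameter (U k) <= d%:E) /\ A `<=` \bigcup_k U k].

Definition hausdorff2_pre d A : \bar R :=
  ereal_inf [set \sum_(k <oo) diameter (U k) ^+ 2 | U in small_cover d A].

(* The factor pi / 4 normalizes the two-dimensional Hausdorff measure so that
   it agrees with the surface area. *)
Definition hausdorff2 A : \bar R :=
  (pi / 4)%:E *
  ereal_sup [set hausdorff2_pre d A | d in [set d : R | (0 < d)%R]].

Lemma diameter_ge0 A : 0 <= diameter A.
Proof. by apply: ereal_sup_ubound; left. Qed.

Lemma diameter2_ge0 A : 0 <= diameter A ^+ 2.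
Proof. by rewrite expe2 mule_ge0 ?diameter_ge0. Qed.

Lemma diameter0 : diameter (set0 : set E) = 0.
Proof.
rewrite /diameter [X in _ |` X](_ : _ = set0) ?setU0 ?ereal_sup1//.
by apply/seteqP; split => // x [[a b] [[]]].
Qed.

Lemma hausdorff2_pre_ge0 d A : 0 <= hausdorff2_pre d A.
Proof.
apply: le_ereal_inf_tmp => x [U _ <-].
by apply: nneseries_ge0 => k _ _; exact: diameter2_ge0.
Qed.

Lemma le_hausdorff2_pre d A B : A `<=` B ->
  hausdorff2_pre d A <= hausdorff2_pre d B.
Proof.
move=> AB; apply/ereal_inf_le_tmp => x [U [dU BU] <-].
by exists U => //; split => //; exact: subset_trans BU.
Qed.

Lemma hausdorff2_pre0 d : (0 < d)%R -> hausdorff2_pre d set0 = 0.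
Proof.
move=> d0; apply/eqP; rewrite eq_le hausdorff2_pre_ge0 andbT.
apply: ereal_inf_lbound; exists (fun=> set0).
  by split => // k; rewrite diameter0 lee_fin ltW.
by rewrite eseries0// => k _ _; rewrite diameter0 expe2 mule0.
Qed.

Lemma hausdorff2_pre_sigma_subadditive d : sigma_subadditive (hausdorff2_pre d).
Proof.
move=> A; have [[i ioo]|] := pselect (exists i, hausdorff2_pre d (A i) = +oo).
  rewrite (eseries_pinfty _ _ ioo) ?leey// => n _.
  by rewrite -ltNye (lt_le_trans _ (hausdorff2_pre_ge0 _ _)).
rewrite -forallNE => Aoo.
suff add2e (e : {posnum R}) : hausdorff2_pre d (\bigcup_n A n) <=
    \sum_(i <oo) hausdorff2_pre d (A i) + e%:num%:E.
  by apply/lee_addgt0Pr => _/posnumP[].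
rewrite (le_trans _ (epsilon_trick _ _ _))//; last first.
  by move=> n; exact: hausdorff2_pre_ge0.
pose mu (B : set E) : \bar R := diameter B ^+ 2.
have mu_ge0 B : 0 <= mu B by exact: diameter2_ge0.
pose P n (B : (set E)^nat) := small_cover d (A n) B /\
  \sum_(k <oo) mu (B k) <=
    hausdorff2_pre d (A n) + (e%:num / (2 ^ n.+1)%:R)%:E.
have [G PG] : {G : ((set E)^nat)^nat & forall n, P n (G n)}.
  apply: (@choice _ _ P) => n; rewrite /P /hausdorff2_pre.
  set S := (X in ereal_inf X); move infS : (ereal_inf S) => iS.
  case: iS infS => [r Sr|Soo|Soo].
  - have en1 : (0 < e%:num / (2 ^ n.+1)%:R)%R by [].
    have /(lb_ereal_inf_adherent en1) : ereal_inf S \is a fin_num by rewrite Sr.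
    move=> [x [B [mB AnB muBx] xS]].
    by exists B; split => //; rewrite muBx -Sr; exact/ltW.
  - by have := Aoo n; rewrite /hausdorff2_pre -/S Soo.
  - suff : lbound S 0 by move/le_ereal_inf_tmp; rewrite Soo.
    by move=> /= _ [B [mB AnB] <-]; apply: nneseries_ge0 => k _ _; exact: mu_ge0.
have muG_ge0 x : 0 <= (mu \o uncurry G) x by exact: mu_ge0.
apply: (@le_trans _ _ (\esum_(i in setT) (mu \o uncurry G) i)).
  apply: ereal_inf_lbound => /=.
  have /card_esym/ppcard_eqP[h] := card_nat2.
  exists (uncurry G \o h).
    split => [i|]; first by rewrite /= /uncurry; case: (h i) => a b; exact: (PG a).1.1.
    apply: (@subset_trans _  (\bigcup_n \bigcup_k G n k)) => [t [i _]|].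
      by move=> /((PG i).1.2) -[j _ ?]; exists i => //; exists j.
    move=> t [i _ [j _ Bijt]]; exists (h^-1%FUN (i, j)) => //=.
    by rewrite invK ?inE.
  rewrite -(esum_pred_image (mu \o uncurry G) _ xpredT) ?[fun=> _]set_true//.
  by rewrite image_eq.
rewrite (_ : esum _ _ = \sum_(i <oo) \sum_(j <oo ) mu (G i j)); last first.
  pose J : nat -> set (nat * nat) := fun i => [set (i, j) | j in setT].
  rewrite (_ : setT = \bigcup_k J k); last first.
    by rewrite predeqE => -[a b]; split => // _; exists a => //; exists b.
  rewrite esum_bigcupT /=; last 2 first.
    - apply/trivIsetP => i j _ _ ij.
      rewrite predeqE => -[n m] /=; split => //= -[] [_] _ [<-{n} _].
      by move=> [m' _] [] /esym/eqP; rewrite (negbTE ij).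
    - by move=> /= [n m]; exact: mu_ge0.
  rewrite -(image_id [set: nat]) -fun_true esum_pred_image//; last first.
    by move=> n _; exact: esum_ge0.
  apply: eq_eseriesr => /= j _.
  rewrite -(esum_pred_image (mu \o uncurry G) (pair j) predT)//=; last first.
    by move=> ? ? _ _; exact: (@can_inj _ _ _ snd).
  by congr esum; rewrite predeqE => -[a b]; split; move=> [i _ <-]; exists i.
apply: lee_lim.
- apply: is_cvg_nneseries => n *.
  by apply: nneseries_ge0 => m *; exact: (muG_ge0 (n, m)).
- by apply: is_cvg_nneseries => n *; apply: adde_ge0 => //; exact: hausdorff2_pre_ge0.
- by near=> n; apply: lee_sum => i _; exact: (PG i).2.
Unshelve. all: by end_near. Qed.

Let c_ge0 : (0 <= pi / 4 :> R)%R.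
Proof. by rewrite divr_ge0// pi_ge0. Qed.

Let sup_ge0 A :
  0 <= ereal_sup [set hausdorff2_pre d A | d in [set d : R | (0 < d)%R]].
Proof.
apply: (@le_trans _ _ (hausdorff2_pre 1 A)); first exact: hausdorff2_pre_ge0.
by apply: ereal_sup_ubound; exists 1%R => /=.
Qed.

Lemma hausdorff2_set0 : hausdorff2 set0 = 0.
Proof.
rewrite /hausdorff2 [X in _ * X](_ : _ = 0) ?mule0//.
apply/eqP; rewrite eq_le sup_ge0 andbT; apply: ge_ereal_sup => x [d d0 <-].
by rewrite hausdorff2_pre0.
Qed.

Lemma hausdorff2_ge0 A : 0 <= hausdorff2 A.
Proof. by rewrite mule_ge0// lee_fin. Qed.

Lemma le_hausdorff2 : {homo hausdorff2 : A B / A `<=` B >-> A <= B}.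
Proof.
move=> A B AB; rewrite lee_wpmul2l ?lee_fin//.
apply: ge_ereal_sup => x [d d0 <-]; apply: (le_trans (le_hausdorff2_pre d AB)).
by apply: ereal_sup_ubound; exists d.
Qed.

Lemma hausdorff2_sigma_subadditive : sigma_subadditive hausdorff2.
Proof.
move=> A; rewrite /hausdorff2 nneseriesZl; last by move=> n _; exact: sup_ge0.
rewrite lee_wpmul2l ?lee_fin//; apply: ge_ereal_sup => x [d d0 <-].
apply: (le_trans (hausdorff2_pre_sigma_subadditive d A)).
apply: lee_nneseries => [k _ _|k _]; first exact: hausdorff2_pre_ge0.
by apply: ereal_sup_ubound; exists d.
Qed.

HB.instance Definition _ := isOuterMeasure.Build R E hausdorff2
  hausdorff2_set0 hausdorff2_ge0 le_hausdorff2 hausdorff2_sigma_subadditive.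

Definition surface_measure : set (caratheodory_type hausdorff2) -> \bar R :=
  hausdorff2.

HB.instance Definition _ := isMeasure.Build _ _ _ surface_measure
  (@caratheodory_measure0 R E hausdorff2)
  (@caratheodory_measure_ge0 R E hausdorff2)
  (@caratheodory_measure_sigma_additive R E hausdorff2).

End Hausdorff.

Section Elastostatics.
Variable R : realType.
Local Notation E := 'rV[R]_3.
Local Notation vfield := (E -> 'cV[R]_3).
Local Notation tfield := (E -> 'M[R]_3).
Local Notation compliance := (E -> 'I_3 -> 'I_3 -> 'I_3 -> 'I_3 -> R).
Implicit Types (x n : E) (g : E -> R) (Omega Gu Gt : set E) (C : compliance)
  (f u w ubar tbar : vfield) (s : tfield).

Definition point (p : R * R * R) : E :=
  \row_i nth 0 [:: p.1.1; p.1.2; p.2] i.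

Definition volume_integral Omega g : R :=
  \int[((@lebesgue_measure R \x @lebesgue_measure R)
         \x @lebesgue_measure R)%E]_(p in point @^-1` Omega) g (point p).

Definition surface_integral Gu g : R :=
  \int[@surface_measure R]_(x in Gu) g x.

(* A bounded domain whose boundary has finite area and almost everywhere a
   unit normal. *)
Definition domain_with_normal Omega : Prop :=
  [/\ [/\ open Omega, connected Omega, Omega !=set0 & bounded_set Omega],
      (surface_measure (boundary Omega) < +oo)%E &
      surface_measure
        (boundary Omega `&` [set x | ~ exists n, outward_normal Omega x n])
      = 0%E].

Definition pd (i : 'I_3) g x : R := 'D_(delta_mx 0 i) g x.

Definition C0_closure Omega g : Prop := {within closure Omega, continuous g}.

Definition C1_closure Omega g : Prop :=
  [/\ C0_closure Omega g,
      forall i x, Omega x -> derivable g x (delta_mx 0 i) &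
      forall i, exists2 h : E -> R, C0_closure Omega h &
        forall x, Omega x -> pd i g x = h x].

(* Components in the order 11, 21, 31, 12, 22, 32, 13, 23, 33. *)
Definition row_of (a : 'I_9) : 'I_3 := inord (a %% 3).
Definition col_of (a : 'I_9) : 'I_3 := inord (a %/ 3).

Definition vec (A : 'M[R]_3) : 'cV[R]_9 := \col_a A (row_of a) (col_of a).

Definition compliance_mx C x : 'M[R]_9 :=
  \matrix_(a, b) C x (row_of a) (col_of a) (row_of b) (col_of b).

Definition moment_mx : 'M[R]_(3, 9) :=
  \matrix_(i, a) nth 0 (nth [::]
    [:: [:: 0; 0; 0;  0; 0; 1;  0; -1; 0];
        [:: 0; 0; 1;  0; 0; 0; -1;  0; 0];
        [:: 0; 1; 0; -1; 0; 0;  0;  0; 0]] i) a.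

Definition divergence s x : 'cV[R]_3 :=
  \col_j \sum_i pd i (fun y => s y i j) x.

Definition traction s x n : 'cV[R]_3 := \col_j \sum_i s x i j * n 0 i.

Definition strain u x : 'M[R]_3 :=
  \matrix_(i, j) (2^-1 * (pd j (fun y => u y i 0) x + pd i (fun y => u y j 0) x)).

(* The symmetries of the compliance tensor of a linear elastic material.  The
   dependence on x allows for inhomogeneous materials. *)
Definition elastic_compliance Omega C : Prop :=
  [/\ forall i j k l, C0_closure Omega (fun x => C x i j k l),
      forall x, closure Omega x -> forall i j k l, C x i j k l = C x k l i j &
      forall x, closure Omega x -> forall i j k l, C x i j k l = C x j i k l].

Definition Lagrangian Omega Gu C f ubar s u w : R :=
  2^-1 * volume_integral Omega
           (fun x => ((vec (s x))^T *m compliance_mx C x *m vec (s x)) 0 0)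
  - surface_integral Gu
      (fun x => ((traction s x (normal Omega x))^T *m ubar x) 0 0)
  + volume_integral Omega (fun x => ((u x)^T *m (divergence s x + f x)) 0 0)
  - volume_integral Omega (fun x => ((w x)^T *m moment_mx *m vec (s x)) 0 0).

Definition has_traction Omega Gt s tbar : Prop :=
  forall x n, Gt x -> outward_normal Omega x n -> traction s x n = tbar x.

Definition stress_space Omega s : Prop :=
  forall i j, C1_closure Omega (fun x => s x i j).

Definition displacement_space Omega u : Prop :=
  forall j, C1_closure Omega (fun x => u x j 0).

Definition rotation_space Omega w : Prop :=
  forall j, C0_closure Omega (fun x => w x j 0).

(* The tractions on Gt are prescribed: they are an essential condition on the
   stresses, so that the admissible variations of s have no traction on Gt. *)
Definition stationary_point Omega Gu Gt C f ubar tbar s u w : Prop :=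
  let L := Lagrangian Omega Gu C f ubar in
  [/\ [/\ stress_space Omega s, has_traction Omega Gt s tbar,
          displacement_space Omega u & rotation_space Omega w],
      forall ds : tfield, stress_space Omega ds ->
        has_traction Omega Gt ds (fun=> 0) ->
        is_derive (0 : R) (1 : R) (fun t : R => L (s + t *: ds) u w) 0,
      forall du : vfield, displacement_space Omega du ->
        is_derive (0 : R) (1 : R) (fun t : R => L s (u + t *: du) w) 0 &
      forall dw : vfield, rotation_space Omega dw ->
        is_derive (0 : R) (1 : R) (fun t : R => L s u (w + t *: dw)) 0].

End Elastostatics.

(* Main.v *)
From Pilot Require Import Defs.
From HB Require Import structures.
From mathcomp Require Import all_boot all_order all_algebra.
From mathcomp Require Import all_classical all_reals all_analysis.
From mathcomp Require Import measurable_realfun.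
From mathcomp Require Import ring lra.
Import Order.TTheory GRing.Theory Num.Theory.
Import numFieldNormedType.Exports.
Local Open Scope classical_set_scope.
Local Open Scope ring_scope.

(** Every equation of the conclusion that holds inside Omega is obtained by
    varying one argument of the Lagrangian by a test function times a constant
    vector or tensor.  Along such a variation the Lagrangian is a quadratic
    polynomial in the parameter, so stationarity says that its linear coefficient
    vanishes.  This coefficient is the integral of the test function against a
    residual, and the fundamental lemma of the calculus of variations
    ([bump_test_eq0]) makes the residual vanish at every point of Omega.

    Varying u gives equilibrium of forces ([force_equilibrium]), and varying w
    gives equilibrium of moments, that is, the symmetry of the stress
    ([moment_equilibrium]).  For the constitutive equations ([constitutive]) the
    stress is varied by a test function times a symmetric tensor.  Such a
    variation does no work on the rotation, and it vanishes near the boundary, so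
    that it is admissible and leaves the term with the prescribed displacements
    unchanged.  What remains is the compliance term, symmetrized by the major
    symmetry of C, and the integral of u against the divergence of the variation.
    The latter is integrated by parts ([volume_integral_by_parts_bump]): as the
    test function is supported in a cube inside Omega, this only takes Fubini's
    theorem and the fundamental theorem of calculus on line segments.  The minor
    symmetry of C then yields the strain.

    The tractions along Gt are an essential condition, satisfied by every
    admissible stress, so the equation there is part of the hypothesis.

    The test functions are t |-> (max 0 t)^2 composed with
    x |-> r^2 - |x - a|^2, for the Euclidean norm.  They are C1, and their
    derivatives are explicit. *)

(** * Coordinates and Lebesgue measure in space *)

Section Coordinates.
Set Implicit Arguments.
Unset Strict Implicit.
Variable R : realType.
Local Notation E := 'rV[R]_3.
Local Notation point := (@Pilot.Defs.point R).
Implicit Types (p : R * R * R) (a x y : E) (A : set E) (r t : R).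

(** The three values of an index, in closed form so that matrix entries at them
    can be computed. *)
Definition o0 : 'I_3 := @Ordinal 3 0 isT.
Definition o1 : 'I_3 := @Ordinal 3 1 isT.
Definition o2 : 'I_3 := @Ordinal 3 2 isT.

Lemma forall_ord3 (P : 'I_3 -> Prop) : P o0 -> P o1 -> P o2 -> forall i, P i.
Proof.
move=> P0 P1 P2 [[|[|[|//]]] i3].
- by rewrite (_ : Ordinal i3 = o0)//; exact: val_inj.
- by rewrite (_ : Ordinal i3 = o1)//; exact: val_inj.
- by rewrite (_ : Ordinal i3 = o2)//; exact: val_inj.
Qed.

Lemma sum_ord3 (V : nmodType) (F : 'I_3 -> V) :
  \sum_i F i = F o0 + F o1 + F o2.
Proof.
rewrite !big_ord_recl big_ord0 addr0 addrA.
by congr (F _ + F _ + F _); exact: val_inj.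
Qed.

Lemma point_0 p : point p 0 o0 = p.1.1. Proof. by rewrite mxE. Qed.
Lemma point_1 p : point p 0 o1 = p.1.2. Proof. by rewrite mxE. Qed.
Lemma point_2 p : point p 0 o2 = p.2. Proof. by rewrite mxE. Qed.

(** The closed cube with centre a and edge length 2r. *)
Definition cube a r : set E := [set x | forall i, x 0 i \in `[a 0 i - r, a 0 i + r]].

Lemma point_cube a r : point @^-1` cube a r =
  (`[a 0 o0 - r, a 0 o0 + r] `*` `[a 0 o1 - r, a 0 o1 + r])
  `*` `[a 0 o2 - r, a 0 o2 + r].
Proof.
apply/seteqP; split => p /=.
  move=> h; split; first split.
  - by rewrite -point_0; exact: h.
  - by rewrite -point_1; exact: h.
  - by rewrite -point_2; exact: h.
move=> [[h0 h1] h2]; apply: forall_ord3.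
- by rewrite point_0.
- by rewrite point_1.
- by rewrite point_2.
Qed.

Lemma open_cube_sub A x : open A -> A x ->
  exists2 e : R, 0 < e & forall y, (forall i, `|x 0 i - y 0 i| < e) -> A y.
Proof.
rewrite openE => /[apply]; rewrite /interior => /nbhs_ballP[e /= e0 h].
exists e => // y xy; apply: h; split => // i j.
by rewrite (ord1 i); exact: xy.
Qed.

Lemma open_sub_cube A x : open A -> A x ->
  exists2 r : R, 0 < r & cube x r `<=` A.
Proof.
move=> oA Ax; have [e e0 h] := open_cube_sub oA Ax.
exists (e / 2); first by rewrite divr_gt0.
move=> y yx; apply: h => i; have := yx i; rewrite in_itv/= => /andP[y1 y2].
by rewrite ltr_norml; apply/andP; split; lra.
Qed.

(** An open set is the union of the open cubes with rational centre and radius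
    that it contains, and there are only countably many of those. *)
Lemma open_point_measurable A : open A -> measurable (point @^-1` A).
Proof.
move=> oA.
pose K (c : rat * rat * rat * rat) : set (R * R * R) :=
  let I d := `]ratr d - ratr c.2, ratr d + ratr c.2[%classic : set R in
  (I c.1.1.1 `*` I c.1.1.2) `*` I c.1.2.
pose F c := if `[< K c `<=` point @^-1` A >] then K c else set0.
have -> : point @^-1` A = \bigcup_c F c.
  apply/seteqP; split => [p Ap|p [c _]]; last first.
    by rewrite /F; case: asboolP => // + Kp; exact.
  have [e e0 h] := open_cube_sub oA Ap.
  have [q] : exists q, ratr q \in `](0 : R), (e / 2)[.
    by apply: rat_in_itvoo; lra.
  rewrite in_itv/= => /andP[q0 qe].
  have near_rat (t : R) : exists d, `|t - ratr d| < ratr q.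
    have [d] : exists d, ratr d \in `]t - ratr q, t + ratr q[.
      by apply: rat_in_itvoo; lra.
    by rewrite in_itv/= => /andP[? ?]; exists d; rewrite ltr_norml; lra.
  have [d0 h0] := near_rat p.1.1; have [d1 h1] := near_rat p.1.2.
  have [d2 h2] := near_rat p.2.
  (* A cube of radius q < e / 2 whose centre is within q of p contains p and
     stays within e of p. *)
  exists (d0, d1, d2, q) => //; rewrite /F.
  move: h0 h1 h2; rewrite !ltr_norml => /andP[? ?] /andP[? ?] /andP[? ?].
  case: asboolP => [_|[]].
    by rewrite /K/=; do ![split]; rewrite /= in_itv/=; lra.
  move=> y; rewrite /K/= !in_itv/= => -[[/andP[? ?] /andP[? ?]] /andP[? ?]].
  apply: h; apply: forall_ord3; rewrite ?(point_0, point_1, point_2);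
    rewrite ltr_norml; lra.
apply: countable_bigcupT_measurable; first exact: countableP.
move=> c; rewrite /F; case: asboolP => // _.
by apply: measurableX; first apply: measurableX; exact: measurable_itv.
Qed.

Local Notation vol :=
  ((@lebesgue_measure R \x @lebesgue_measure R) \x @lebesgue_measure R)%E.

Lemma vol_cube a r : 0 < r ->
  vol (point @^-1` cube a r) = ((r *+ 2) ^+ 3)%:E.
Proof.
move=> r0; rewrite point_cube product_measure1E//; last exact: measurableX.
rewrite [X in (X * _)%E]product_measure1E//= !lebesgue_measure_itv/= !lte_fin.
rewrite !ifT; [|lra..].
by rewrite -!EFinD -!EFinM; congr EFin; ring.
Qed.

Lemma bounded_vol_fin A : open A -> bounded_set A ->
  (vol (point @^-1` A) < +oo)%E.
Proof.
move=> oA [M [_ Mb]].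
have M0 : 0 < `|M| + 1 by rewrite ltr_pwDr.
apply: (@le_lt_trans _ _ (vol (point @^-1` cube 0 (`|M| + 1)))); last first.
  by rewrite vol_cube// ltry.
apply: le_measure; rewrite ?inE.
- exact: open_point_measurable.
- by rewrite point_cube; do 2?apply: measurableX.
move=> p Ap i; rewrite [(0 : E) 0 i]mxE.
have : `|point p| <= `|M| + 1.
  by apply: (Mb (`|M| + 1)) => //; rewrite (le_lt_trans (ler_norm _))// ltrDl.
rewrite {1}/Num.norm/= mx_normrE => h.
have : `|point p 0 i| <= `|M| + 1.
  by apply: le_trans h; exact: (@le_bigmax _ _ _ _ (fun ij : 'I_1 * 'I_3 => `|point p ij.1 ij.2|) (0, i)).
by rewrite ler_norml in_itv/= sub0r add0r.
Qed.

End Coordinates.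

(** * Integrands continuous up to the boundary *)

Section Integrands.
Set Implicit Arguments.
Unset Strict Implicit.
Variable R : realType.
Local Notation E := 'rV[R]_3.
Local Notation point := (@Pilot.Defs.point R).
Local Notation vol :=
  ((@lebesgue_measure R \x @lebesgue_measure R) \x @lebesgue_measure R)%E.
Implicit Types (g h : E -> R) (x : E) (Omega : set E).

(** g agrees on Omega with a function that is continuous on the closure.  The
    derivatives of the fields are only controlled inside Omega, where the
    integrals are taken, so this is the class to which all the integrands
    belong. *)
Definition extends_C0 Omega g : Prop :=
  exists2 h, C0_closure Omega h & forall x, Omega x -> g x = h x.

Lemma C0_extends Omega g : C0_closure Omega g -> extends_C0 Omega g.
Proof. by exists g. Qed.

Lemma continuous_extends Omega g : continuous g -> extends_C0 Omega g.
Proof. by move=> cg; apply: C0_extends; exact: continuous_subspaceT. Qed.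

Lemma eq_extends Omega g h : (forall x, Omega x -> g x = h x) ->
  extends_C0 Omega h -> extends_C0 Omega g.
Proof. by move=> gh [k ck hk]; exists k => // x Ox; rewrite gh// hk. Qed.

Lemma extends_cst Omega (c : R) : extends_C0 Omega (fun=> c).
Proof. by apply: continuous_extends; exact: cst_continuous. Qed.

Lemma extendsD Omega g h : extends_C0 Omega g -> extends_C0 Omega h ->
  extends_C0 Omega (fun x => g x + h x).
Proof.
move=> [g' cg gg'] [h' ch hh']; exists (fun x => g' x + h' x).
  by move=> x; apply: cvgD; [exact: cg|exact: ch].
by move=> x Ox; rewrite gg'// hh'.
Qed.

Lemma extendsM Omega g h : extends_C0 Omega g -> extends_C0 Omega h ->
  extends_C0 Omega (fun x => g x * h x).
Proof.
move=> [g' cg gg'] [h' ch hh']; exists (fun x => g' x * h' x).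
  by move=> x; apply: cvgM; [exact: cg|exact: ch].
by move=> x Ox; rewrite gg'// hh'.
Qed.

Lemma extendsN Omega g : extends_C0 Omega g -> extends_C0 Omega (fun x => - g x).
Proof.
move=> eg; apply: (@eq_extends _ _ (fun x => -1 * g x)).
  by move=> x _; rewrite mulN1r.
by apply: extendsM => //; exact: extends_cst.
Qed.

Lemma extends_sum Omega n (F : 'I_n -> E -> R) :
  (forall i, extends_C0 Omega (F i)) ->
  extends_C0 Omega (fun x => \sum_i F i x).
Proof.
elim: n F => [|n ih] F eF.
  apply: (@eq_extends _ _ (fun=> 0)) => [x _|]; first by rewrite big_ord0.
  exact: extends_cst.
apply: (@eq_extends _ _ (fun x => F ord0 x + \sum_i F (lift ord0 i) x)).
  by move=> x _; rewrite big_ord_recl.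
by apply: extendsD => //; exact: ih.
Qed.

Lemma extends_continuous_at Omega g x : open Omega -> extends_C0 Omega g ->
  Omega x -> {for x, continuous g}.
Proof.
move=> oO [h ch gh] Ox.
have nO : nbhs x Omega by exact: open_nbhs_nbhs.
have : {within Omega, continuous h}.
  exact: continuous_subspaceW (@subset_closure _ _) ch.
rewrite continuous_open_subspace// => /(_ x (mem_set Ox)) hx.
rewrite /prop_for /continuous_at gh//; apply: cvg_trans hx.
apply: (@near_eq_cvg _ _ (nbhs x)); apply: filterS nO => y Oy; exact/esym/gh.
Qed.

(** The closure of a bounded set is compact. *)
Lemma extends_bounded Omega g : bounded_set Omega -> extends_C0 Omega g ->
  exists M, forall x, Omega x -> `|g x| <= M.
Proof.
move=> bO [h ch gh].
have bcO : bounded_set (closure Omega).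
  have [M [Mr Mb]] := bO; exists M; split => // e Me x.
  have cl : closed [set y : E | `|y| <= e].
    rewrite (_ : [set _ | _] = (fun y : E => `|y|) @^-1` [set t : R | t <= e])//.
    by apply: closed_comp; [move=> y _; exact: norm_continuous|exact: closed_le].
  by move=> cx; apply: cl; apply: closure_subset cx => y Oy; exact: Mb.
have := continuous_compact ch (bounded_closed_compact bcO (@closed_closure _ _)).
move=> /compact_bounded[M [_ Mb]]; exists (`|M| + 1) => x Ox.
rewrite gh//; apply: (Mb (`|M| + 1)).
  by rewrite (le_lt_trans (ler_norm _))// ltrDl.
by exists x => //; exact: subset_closure.
Qed.

Lemma extends_measurable Omega g : open Omega -> extends_C0 Omega g ->
  measurable_fun (point @^-1` Omega) (g \o point).
Proof.
move=> oO eg mO; apply: (measurability _ (RGenOpens.measurableE R)) => //.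
move=> _ [_ [a [b ->] <-]]/=.
rewrite (_ : _ `&` _ =
    point @^-1` (Omega `&` g @^-1` `]a, b[%classic)).
  apply: open_point_measurable; rewrite openE => x [Ox gx].
  apply: filterI; first exact: open_nbhs_nbhs.
  apply: (extends_continuous_at oO eg Ox).
  by apply: open_nbhs_nbhs; split => //; exact: interval_open.
by apply/seteqP; split.
Qed.

Lemma extends_integrable Omega g : open Omega -> bounded_set Omega ->
  extends_C0 Omega g ->
  vol.-integrable (point @^-1` Omega) (EFin \o (g \o point)).
Proof.
move=> oO bO eg; apply: measurable_bounded_integrable.
- exact: open_point_measurable.
- exact: bounded_vol_fin.
- exact: extends_measurable.
- have [M hM] := extends_bounded bO eg; exists M; split; first exact: num_real.
  by move=> y My p Op; apply: le_trans (hM _ Op) _; exact: ltW.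
Qed.

Lemma eq_volume_integral Omega g h : (forall x, Omega x -> g x = h x) ->
  volume_integral Omega g = volume_integral Omega h.
Proof. by move=> gh; apply: eq_Rintegral => p /set_mem Op; exact: gh. Qed.

Lemma volume_integralD Omega g h : open Omega -> bounded_set Omega ->
  extends_C0 Omega g -> extends_C0 Omega h ->
  volume_integral Omega (fun x => g x + h x) =
  volume_integral Omega g + volume_integral Omega h.
Proof.
move=> oO bO eg eh; rewrite /volume_integral.
refine (@RintegralD _ _ R vol _ (g \o point) (h \o point) _ _ _).
- exact: open_point_measurable.
- exact: extends_integrable.
- exact: extends_integrable.
Qed.

Lemma volume_integralZ Omega g (c : R) : open Omega -> bounded_set Omega ->
  extends_C0 Omega g ->
  volume_integral Omega (fun x => c * g x) = c * volume_integral Omega g.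
Proof.
move=> oO bO eg; rewrite /volume_integral.
refine (@RintegralZl _ _ R vol _ (g \o point) c _ _).
- exact: open_point_measurable.
- exact: extends_integrable.
Qed.

End Integrands.

(** * Derivatives along lines and the test functions *)

Section LineDerivative.
Set Implicit Arguments.
Unset Strict Implicit.
Variable R : realType.
Implicit Types (V : normedModType R).

(** A directional derivative is an ordinary derivative along a line. *)
Lemma is_derive_line V (f : V -> R) (x v : V) (t d : R) :
  is_derive (x + t *: v) v f d <->
  is_derive t 1 (fun h : R => f (x + h *: v)) d.
Proof.
have qE : (fun h : R => h^-1 *: ((f \o shift (x + t *: v)) (h *: v) -
                                 f (x + t *: v))) =
          (fun h : R => h^-1 *: (((fun s : R => f (x + s *: v)) \o shift t)
                                   (h *: (1 : R)) - f (x + t *: v))).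
  apply/funext => h /=; congr (_ *: (f _ - _)).
  by rewrite [h *: (1 : R)]mulr1 scalerDl [LHS]addrCA.
split=> -[dx dE]; apply: DeriveDef.
- by rewrite /derivable -qE.
- by rewrite /derive -qE.
- by rewrite /derivable qE.
- by rewrite /derive qE.
Qed.

Lemma is_derive_quadratic (A B C : R) :
  is_derive (0 : R) (1 : R) (fun t : R => A + t * B + t ^+ 2 * C) B.
Proof.
have -> : (fun t : R => A + t * B + t ^+ 2 * C) =
    cst A + B \*: (id : R -> R) + C \*: (id : R -> R) ^+ 2.
  apply/funext => t; change (A + t * B + t ^+ 2 * C = A + B * t + C * t ^+ 2).
  by ring.
apply: is_derive_eq.
by rewrite -![_ *: _]/(_ * _); ring.
Qed.

Lemma is_derive_pos_sqr (v : R) :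
  is_derive v 1 (fun t : R => Num.max 0 t ^+ 2) (2 * Num.max 0 v).
Proof.
(* t |-> (max 0 t)^2 has a 2-Lipschitz derivative, whence the quadratic
   remainder. *)
have taylor h : `|Num.max 0 (v + h) ^+ 2 - Num.max 0 v ^+ 2
                  - h * (2 * Num.max 0 v)| <= h ^+ 2.
  rewrite ler_norml; case: (leP 0 v) => v0; case: (leP 0 (v + h)) => vh;
    by apply/andP; split; nra.
suff cvgq : (fun h : R => h^-1 *: (((fun t : R => Num.max 0 t ^+ 2) \o shift v)
      (h *: (1 : R)) - Num.max 0 v ^+ 2)) @ 0^' --> (2 * Num.max 0 v).
  by apply: DeriveDef; [exact: cvgP cvgq|exact: cvg_lim cvgq].
apply/cvgrPdist_le => e e0; near=> h.
have h0 : h != 0 by near: h; exact: nbhs_dnbhs_neq.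
rewrite -[X in `|X - _|](mulKf h0) [X in `|_ - X|]/GRing.scale/= -mulrBr normrM.
rewrite normfV ler_pdivrMl ?normr_gt0// distrC.
rewrite /= [h *: _]mulr1 [h + v]addrC (le_trans (taylor h))//.
rewrite -real_normK ?num_real// expr2 ler_wpM2l//.
near: h; apply: dnbhs0_le; exact: e0.
Unshelve. all: by end_near. Qed.

End LineDerivative.

Section Bump.
Set Implicit Arguments.
Unset Strict Implicit.
Variable R : realType.
Local Notation E := 'rV[R]_3.
Implicit Types (a x y : E) (r t : R) (i : 'I_3).

(** For r > 0, positive exactly inside the Euclidean ball of centre a and radius r. *)
Definition depth a r x : R := r ^+ 2 - dotp (x - a) (x - a).

(** The test function: it is C1 on the whole space and, for r > 0, positive in the
    open ball of centre a and radius r and zero outside that ball. *)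
Definition bump a r x : R := Num.max 0 (depth a r x) ^+ 2.

(** The partial derivative of bump a r in the direction i. *)
Definition dbump a r i x : R :=
  2 * Num.max 0 (depth a r x) * (- 2 * (x 0 i - a 0 i)).

Lemma depthE a r x : depth a r x = r ^+ 2 - ((x 0 o0 - a 0 o0) ^+ 2 +
  (x 0 o1 - a 0 o1) ^+ 2 + (x 0 o2 - a 0 o2) ^+ 2).
Proof. by rewrite /depth /dotp sum_ord3 !mxE !expr2. Qed.

Lemma is_derive_bump a r i x : is_derive x (delta_mx 0 i) (bump a r) (dbump a r i x).
Proof.
rewrite -[x]addr0 -(scale0r (delta_mx 0 i)); apply/is_derive_line.
rewrite scale0r addr0.
pose k (t : R) := depth a r x + t * (- 2 * (x 0 i - a 0 i)) + t ^+ 2 * (-1).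
have k0 : k 0 = depth a r x by rewrite /k; ring.
have -> : (fun t : R => bump a r (x + t *: delta_mx 0 i)) =
    (fun t : R => Num.max 0 t ^+ 2) \o k.
  apply/funext => t /=; rewrite /bump; congr (Num.max _ _ ^+ 2).
  rewrite /k !depthE {k k0}; move: i; apply: forall_ord3; rewrite !mxE/=; ring.
rewrite /dbump -k0; apply: is_derive1_comp.
  exact: is_derive_pos_sqr.
exact: is_derive_quadratic.
Qed.

Lemma continuous_pos_part : continuous (fun t : R => Num.max 0 t).
Proof.
move=> t; apply: (@continuous_max _ _ (cst 0) id); first exact: cst_continuous.
exact: cvg_id.
Qed.

Lemma continuous_depth a r : continuous (depth a r).
Proof.
have -> : depth a r = fun x => r ^+ 2 - ((x 0 o0 - a 0 o0) ^+ 2 +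
    (x 0 o1 - a 0 o1) ^+ 2 + (x 0 o2 - a 0 o2) ^+ 2).
  by apply/funext => x; rewrite depthE.
have cc i : continuous (fun x : E => (x 0 i - a 0 i) ^+ 2).
  move=> x; apply: (@continuous_comp _ _ _ (fun x : E => x 0 i - a 0 i) (fun t => t ^+ 2)).
    by apply: (@cvgB _ _ _ (nbhs x)); [exact: coord_continuous|exact: cvg_cst].
  exact: exprn_continuous.
move=> x; apply: (@cvgB _ _ _ (nbhs x)); first exact: cvg_cst.
by apply: (@cvgD _ _ _ (nbhs x)); [apply: (@cvgD _ _ _ (nbhs x))|]; exact: cc.
Qed.

Lemma continuous_bump a r : continuous (bump a r).
Proof.
move=> x; apply: (@continuous_comp _ _ _ (fun x => Num.max 0 (depth a r x)) (fun t => t ^+ 2)).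
  apply: (@continuous_comp _ _ _ (depth a r) (fun t => Num.max 0 t)).
    exact: continuous_depth.
  exact: continuous_pos_part.
exact: exprn_continuous.
Qed.

Lemma continuous_dbump a r i : continuous (dbump a r i).
Proof.
move=> x; apply: (@cvgM _ _ (nbhs x)).
  apply: (@cvgM _ _ (nbhs x)); first exact: cvg_cst.
  apply: (@continuous_comp _ _ _ (depth a r) (fun t => Num.max 0 t)).
    exact: continuous_depth.
  exact: continuous_pos_part.
apply: (@cvgM _ _ (nbhs x)); first exact: cvg_cst.
by apply: (@cvgB _ _ _ (nbhs x)); [exact: coord_continuous|exact: cvg_cst].
Qed.

Lemma depth_le0 a r i x : 0 < r -> x 0 i \notin `]a 0 i - r, a 0 i + r[ ->
  depth a r x <= 0.
Proof.
move=> r0; rewrite in_itv/= negb_and -!leNgt => out.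
have ri : r ^+ 2 <= (x 0 i - a 0 i) ^+ 2.
  by case/orP: out => ?; nra.
rewrite depthE; have s j := sqr_ge0 (x 0 j - a 0 j).
have := s o0; have := s o1; have := s o2; move: i {out} ri.
by apply: forall_ord3 => *; lra.
Qed.

Lemma bump_eq0 a r i x : 0 < r -> x 0 i \notin `]a 0 i - r, a 0 i + r[ ->
  bump a r x = 0.
Proof. by move=> r0 out; rewrite /bump max_l ?expr0n// (depth_le0 r0 out). Qed.

Lemma dbump_eq0 a r i j x : 0 < r -> x 0 i \notin `]a 0 i - r, a 0 i + r[ ->
  dbump a r j x = 0.
Proof. by move=> r0 out; rewrite /dbump max_l ?mulr0 ?mul0r// (depth_le0 r0 out). Qed.

Lemma bump_ge0 a r x : 0 <= bump a r x.
Proof. exact: sqr_ge0. Qed.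

Lemma bump_ge a r x : cube a (r / 2) x -> (r ^+ 2 / 4) ^+ 2 <= bump a r x.
Proof.
move=> cx.
have ri i : (x 0 i - a 0 i) ^+ 2 <= r ^+ 2 / 4.
  by have := cx i; rewrite in_itv/= => /andP[? ?]; nra.
have d : r ^+ 2 / 4 <= depth a r x.
  by rewrite depthE; have := ri o0; have := ri o1; have := ri o2; lra.
rewrite /bump lerXn2r ?nnegrE//; last by rewrite le_max d orbT.
- by rewrite divr_ge0// sqr_ge0.
- by rewrite le_max lexx.
Qed.

End Bump.

(** * Vanishing of integrals by Fubini's theorem *)

Section FubiniZero.
Set Implicit Arguments.
Unset Strict Implicit.
Local Open Scope ereal_scope.

Lemma integrable_bounded_support d (T : measurableType d) (R : realType)
    (mu : {measure set T -> \bar R}) (f : T -> R) (A : set T) (M : R) :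
  measurable A -> mu A < +oo -> measurable_fun setT f ->
  (forall x, `|f x| <= M)%R -> (forall x, ~ A x -> f x = 0%R) ->
  mu.-integrable setT (EFin \o f).
Proof.
move=> mA Aoo mf fM f0.
rewrite (_ : EFin \o f = (EFin \o f) \_ A); last first.
  by apply/funext => x /=; rewrite patchE; case: ifPn => // /negP;
    rewrite inE => /f0 ->.
apply: (integrable_mkcond _ mA).1; apply: measurable_bounded_integrable => //.
  exact: measurable_funTS.
exists M; split; first exact: num_real.
by move=> y My x _; apply: (le_trans (fM x)); exact: ltW.
Qed.

Variable R : realType.
Local Notation mu := (@lebesgue_measure R).
(** Planar Lebesgue measure.  Giving the product measure a name makes it possible
    to equip it with its sigma-finiteness, which Fubini's theorem needs for the
    outer product. *)
Definition plane_measure :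
    set (measurableTypeR R * measurableTypeR R) -> \bar R := mu \x mu.

HB.instance Definition _ := Measure.copy plane_measure (mu \x mu)%E.

Lemma plane_measure_sigma_finite : sigma_finite setT plane_measure.
Proof.
have /sigma_finiteP[F [TF ndF Foo]] := sigma_finiteT mu.
exists (fun n => F n `*` F n).
  rewrite -setXTT TF predeqE => -[x y]; split.
    move=> [/= [n _ Fnx] [k _ Fky]]; exists (maxn n k) => //; split.
    - by move: x Fnx; exact/subsetPset/ndF/leq_maxl.
    - by move: y Fky; exact/subsetPset/ndF/leq_maxr.
  by move=> [n _ []/= ? ?]; split; exists n.
move=> k; have [mF Fk] := Foo k; split; first exact: measurableX.
by rewrite /plane_measure product_measure1E// lte_mul_pinfty// ge0_fin_numE.
Qed.

HB.instance Definition _ := Measure_isSigmaFinite.Build _ _ _ plane_measure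
  plane_measure_sigma_finite.

Variables (f : R * R * R -> R) (I0 I1 I2 : interval R) (M : R).
Hypotheses (fin0 : mu [set` I0] < +oo) (fin1 : mu [set` I1] < +oo)
  (fin2 : mu [set` I2] < +oo).
Hypothesis mf : measurable_fun setT f.
Hypothesis fM : forall p, (`|f p| <= M)%R.
Hypothesis f_out : forall p,
  ~ (([set` I0] `*` [set` I1]) `*` [set` I2]) p -> f p = 0%R.

Let fin01 : (mu \x mu) ([set` I0] `*` [set` I1]) < +oo.
Proof. by rewrite product_measure1E// lte_mul_pinfty// ge0_fin_numE. Qed.

Let fin012 :
  (mu \x mu \x mu) (([set` I0] `*` [set` I1]) `*` [set` I2]) < +oo.
Proof.
rewrite product_measure1E//; last exact: measurableX.
by rewrite lte_mul_pinfty// ge0_fin_numE.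
Qed.

Let int3 : (mu \x mu \x mu).-integrable setT (EFin \o f).
Proof.
refine (@integrable_bounded_support _ _ R (mu \x mu \x mu) f
  (([set` I0] `*` [set` I1]) `*` [set` I2]) M _ _ _ _ _) => //.
by apply: measurableX => //; exact: measurableX.
Qed.

Let int2 z : (mu \x mu).-integrable setT (fun q => (f (q, z))%:E).
Proof.
refine (@integrable_bounded_support _ _ R (mu \x mu) (fun q => f (q, z))
  ([set` I0] `*` [set` I1]) M _ _ _ _ _) => //.
- exact: measurableX.
- exact: measurable_fun_pair1.
- by move=> q nq; apply: f_out => -[].
Qed.

(** A bounded function that vanishes outside a box integrates to 0 as soon as
    its integrals along all the lines parallel to one of the axes vanish. *)
Lemma fubini_eq0_z : (forall q, \int[mu]_t (f (q, t))%:E = 0) ->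
  \int[mu \x mu \x mu]_p (f p)%:E = 0.
Proof.
move=> f0; refine (etrans (esym (@integral12_prod_meas1 _ _ _ _ R plane_measure mu _ int3)) _); rewrite /fubini_F.
by apply: integral0_eq => q _; exact: f0.
Qed.

Lemma fubini_eq0_y : (forall x z, \int[mu]_t (f ((x, t), z))%:E = 0) ->
  \int[mu \x mu \x mu]_p (f p)%:E = 0.
Proof.
move=> f0; refine (etrans (esym (@integral21_prod_meas1 _ _ _ _ R plane_measure mu _ int3)) _); rewrite /fubini_G.
apply: integral0_eq => z _; refine (etrans (esym (integral12_prod_meas1 (int2 z))) _).
by apply: integral0_eq => x _; exact: f0.
Qed.

Lemma fubini_eq0_x : (forall y z, \int[mu]_t (f ((t, y), z))%:E = 0) ->
  \int[mu \x mu \x mu]_p (f p)%:E = 0.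
Proof.
move=> f0; refine (etrans (esym (@integral21_prod_meas1 _ _ _ _ R plane_measure mu _ int3)) _); rewrite /fubini_G.
apply: integral0_eq => z _; refine (etrans (esym (integral21_prod_meas1 (int2 z))) _).
by apply: integral0_eq => y _; exact: f0.
Qed.

End FubiniZero.

(** * The fundamental lemma and integration by parts *)

Section Variational.
Set Implicit Arguments.
Unset Strict Implicit.
Variable R : realType.
Local Notation E := 'rV[R]_3.
Local Notation point := (@Pilot.Defs.point R).
Local Notation vol :=
  ((@lebesgue_measure R \x @lebesgue_measure R) \x @lebesgue_measure R)%E.
Implicit Types (g G U : E -> R) (a x : E) (r : R) (Omega : set E).

(** If G were positive at x, it would be at least some c > 0 on a cube around x,
    and the test function of that cube would give a positive integral. *)
Lemma bump_test_le0 Omega G : open Omega -> bounded_set Omega ->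
  extends_C0 Omega G ->
  (forall a r, 0 < r -> cube a r `<=` Omega ->
     volume_integral Omega (fun x => bump a r x * G x) = 0) ->
  forall x, Omega x -> G x <= 0.
Proof.
move=> oO bO eG G0 x Ox; rewrite leNgt; apply/negP => Gx0.
pose c := G x / 2.
have c0 : 0 < c by rewrite divr_gt0.
pose A := Omega `&` G @^-1` `]c, +oo[%classic.
have oA : open A.
  rewrite openE => y [Oy Gy]; apply: filterI; first exact: open_nbhs_nbhs.
  apply: (extends_continuous_at oO eG Oy).
  by apply: open_nbhs_nbhs; split => //; exact: interval_open.
have Ax : A x by split => //; rewrite /= in_itv/= andbT /c; lra.
have [r r0 rA] := open_sub_cube oA Ax.
have rO : cube x r `<=` Omega by move=> y /rA[].
have sub : cube x (r / 2) `<=` cube x r.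
  by move=> y h i; have := h i; rewrite !in_itv/=; lra.
pose k := (r ^+ 2 / 4) ^+ 2 * c.
have k0 : 0 < k by rewrite mulr_gt0// exprn_gt0// divr_gt0// exprn_gt0.
have mO := open_point_measurable oO.
have mQ : measurable (point @^-1` cube x (r / 2)).
  by rewrite point_cube; do 2?apply: measurableX.
have r20 : 0 < r / 2 by rewrite divr_gt0.
(* On the cube of half size the integrand is at least k, and it is nonnegative
   elsewhere. *)
have lower : k * ((r / 2) *+ 2) ^+ 3 <=
    volume_integral Omega (fun x' => bump x r x' * G x').
  have -> : k * ((r / 2) *+ 2) ^+ 3 =
      \int[vol]_(p in point @^-1` Omega) ((cst k) \_ (point @^-1` cube x (r / 2))) p.
    rewrite -Rintegral_mkcondr (_ : _ `&` _ = point @^-1` cube x (r / 2)).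
      rewrite Rintegral_cst//; congr (k * _).
      exact/esym/(congr1 fine (vol_cube x r20)).
    by apply/seteqP; split => [p []//|p cp]; split => //; apply/rO/sub.
  apply: le_Rintegral => //.
  - apply: measurable_bounded_integrable => //.
    + exact: bounded_vol_fin.
    + apply: measurable_funTS; apply/(measurable_restrictT _ mQ).
      exact: measurable_cst.
    + exists k; split; first exact: num_real.
      move=> y ky p _; rewrite /= patchE; case: ifPn => _; last first.
        by rewrite normr0; apply: ltW; apply: lt_trans k0 ky.
      by rewrite /= gtr0_norm// ltW.
  - apply: (@extends_integrable _ Omega (fun x' => bump x r x' * G x')) => //.
    apply: extendsM => //; apply: continuous_extends; exact: continuous_bump.
  - move=> p Op; rewrite /patch; case: ifPn => [/set_mem/= cp|_].
      have [_] := rA _ (sub _ cp); rewrite /= in_itv/= andbT => cG.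
      rewrite ler_pM//; [exact: sqr_ge0|exact: ltW|exact: bump_ge|exact: ltW].
    have [cp|ncp] := pselect (forall i, point p 0 i \in `]x 0 i - r, x 0 i + r[).
      have [|_] := rA (point p).
        by move=> i; have := cp i; rewrite !in_itv/= => /andP[? ?]; apply/andP; split; exact: ltW.
      rewrite /= in_itv/= andbT => cG; rewrite mulr_ge0 ?bump_ge0//.
      exact/ltW/(lt_trans c0).
    move/existsNP : ncp => [i /negP ni].
    by rewrite (bump_eq0 r0 ni) mul0r.
move: lower; rewrite (G0 _ _ r0 rO) leNgt => /negP; apply.
by rewrite mulr_gt0// exprn_gt0// pmulrn_lgt0.
Qed.

(** The fundamental lemma of the calculus of variations, for the test functions
    bump a r. *)
Lemma bump_test_eq0 Omega G : open Omega -> bounded_set Omega ->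
  extends_C0 Omega G ->
  (forall a r, 0 < r -> cube a r `<=` Omega ->
     volume_integral Omega (fun x => bump a r x * G x) = 0) ->
  forall x, Omega x -> G x = 0.
Proof.
move=> oO bO eG G0 x Ox; apply/eqP; rewrite eq_le (bump_test_le0 oO bO eG G0 Ox)/=.
rewrite -oppr_le0; apply: (@bump_test_le0 Omega (fun x => - G x)) => //.
  exact: extendsN.
move=> a r r0 rO.
rewrite (@eq_volume_integral _ _ _ (fun x => -1 * (bump a r x * G x))).
  rewrite volume_integralZ ?G0 ?mulr0//.
  by apply: extendsM => //; apply: continuous_extends; exact: continuous_bump.
by move=> y _; rewrite mulrN mulN1r.
Qed.

Section ByParts.
Variables (Omega : set E) (U : E -> R) (a : E) (r : R) (i : 'I_3).
Hypotheses (oO : open Omega) (bO : bounded_set Omega).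
Hypotheses (CU : C1_closure Omega U) (r0 : 0 < r) (rO : cube a r `<=` Omega).

Let F x := U x * dbump a r i x + bump a r x * pd i U x.

Let eF : extends_C0 Omega F.
Proof.
have [cU _ pU] := CU.
apply: extendsD; apply: extendsM; do ?[exact: C0_extends|exact: pU];
  apply: continuous_extends; [exact: continuous_dbump|exact: continuous_bump].
Qed.

Let F_out x j : x 0 j \notin `]a 0 j - r, a 0 j + r[ -> F x = 0.
Proof.
by move=> out; rewrite /F (dbump_eq0 _ r0 out) (bump_eq0 r0 out) mulr0 mul0r addr0.
Qed.

Let F_outcube x : ~ cube a r x -> F x = 0.
Proof.
move=> /existsNP[j nj]; apply: (@F_out _ j); apply/negP.
by move=> h; apply: nj; move: h; rewrite !in_itv/= => /andP[? ?];
  apply/andP; split; exact: ltW.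
Qed.

Let mF : measurable_fun setT (F \o point).
Proof.
rewrite (_ : F \o point = (F \o point) \_ (point @^-1` Omega)); last first.
  apply/funext => p; rewrite /patch; case: ifPn => // /negP np /=.
  by apply: F_outcube => /rO Op; apply: np; exact/mem_set.
apply/(measurable_restrictT _ (open_point_measurable oO)).
exact: extends_measurable.
Qed.

Let line_deriv x t : cube a r (x + t *: delta_mx 0 i) ->
  is_derive t 1 (fun t : R => U (x + t *: delta_mx 0 i) *
                              bump a r (x + t *: delta_mx 0 i))
    (F (x + t *: delta_mx 0 i)).
Proof.
move=> ct; apply/(is_derive_line (fun x => U x * bump a r x)).
have [_ dU _] := CU.
have := @is_deriveM _ _ U (bump a r) (x + t *: delta_mx 0 i) (delta_mx 0 i) _ _
  (derivableP (dU i _ (rO ct))) (is_derive_bump a r i _).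
exact.
Qed.

Let line_zero x : x 0 i = 0 ->
  (\int[@lebesgue_measure R]_t (F (x + t *: delta_mx 0 i))%:E = 0)%E.
Proof.
move=> xi0.
have coordE t j : (x + t *: delta_mx 0 i) 0 j = if j == i then t else x 0 j.
  rewrite !mxE eqxx/=; case: eqP => [->|_]; first by rewrite xi0 add0r mulr1.
  by rewrite mulr0 addr0.
(* If another coordinate of the line is out of range, then the line misses the
   support of the test function. *)
have [|/existsNP[j /not_implyP[ji /negP nj]]] := pselect
    (forall j, j != i -> x 0 j \in `]a 0 j - r, a 0 j + r[); last first.
  apply: integral0_eq => t _; rewrite (@F_out _ j)//.
  by rewrite coordE (negbTE ji).
move=> inx.
have in_cube t : t \in `[a 0 i - r, a 0 i + r] -> cube a r (x + t *: delta_mx 0 i).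
  move=> ti j; rewrite coordE; case: eqP => [->//|/eqP /inx].
  by rewrite !in_itv/= => /andP[? ?]; apply/andP; split; exact: ltW.
pose g t := F (x + t *: delta_mx 0 i).
pose K t := U (x + t *: delta_mx 0 i) * bump a r (x + t *: delta_mx 0 i).
have dK t : t \in `[a 0 i - r, a 0 i + r] -> is_derive t 1 K (g t).
  by move=> ti; apply: line_deriv; exact: in_cube.
have cK t : t \in `[a 0 i - r, a 0 i + r] -> {for t, continuous K}.
  by move=> /dK[dKt _]; apply: differentiable_continuous; apply/derivable1_diffP.
have K_end t : t \notin `]a 0 i - r, a 0 i + r[ -> K t = 0.
  by move=> nt; rewrite /K (@bump_eq0 _ _ _ i)// ?mulr0// coordE eqxx.
transitivity
    (\int[@lebesgue_measure R]_(t in `[(a 0 i - r)%R, (a 0 i + r)%R]) (g t)%:E)%E.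
  rewrite [RHS]integral_mkcond; apply: eq_integral => t _.
  rewrite patchE; case: ifPn => // /negP nt; congr EFin.
  apply: (@F_out _ i); rewrite coordE eqxx; apply/negP => ti.
  apply: nt; apply/mem_set; move: ti; rewrite /= !in_itv/= => /andP[? ?].
  by apply/andP; split; exact: ltW.
have lt_ends : a 0 i - r < a 0 i + r.
  by rewrite ltrBlDr -addrA ltrDl addr_gt0.
rewrite (@continuous_FTC2 _ g K)//.
- rewrite (K_end (a 0 i + r)) ?(K_end (a 0 i - r)) ?sube0//.
  + by rewrite in_itv/= ltxx.
  + by rewrite in_itv/= ltxx andbF.
- apply: continuous_in_subspaceT => t /set_mem/= ti.
  rewrite /g; apply: (@continuous_comp R E R (fun t : R => x + t *: delta_mx 0 i : E) F).
    by apply: cvgD; [exact: cvg_cst|exact: scalel_continuous].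
  by apply: extends_continuous_at eF _ => //; exact/rO/in_cube.
- split.
  + move=> t ti; have [] // := dK t.
    by move: ti; rewrite !in_itv/= => /andP[? ?]; apply/andP; split; exact: ltW.
  + by apply: cvg_at_right_filter; apply: cK; rewrite in_itv/= lexx ltW.
  + by apply: cvg_at_left_filter; apply: cK; rewrite in_itv/= lexx ltW.
- move=> t ti; rewrite derive1E; have [] // := dK t.
  by move: ti; rewrite !in_itv/= => /andP[? ?]; apply/andP; split; exact: ltW.
Qed.

(** Integration by parts against a test function.  Along a line in the direction
    i the integrand is the derivative of U times the test function, which
    vanishes at both ends of the cube; Fubini's theorem does the rest.  No
    regularity of the boundary of Omega is needed. *)
Lemma volume_integral_by_parts_bump :
  volume_integral Omega
    (fun x => U x * dbump a r i x + bump a r x * pd i U x) = 0.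
Proof.
rewrite /volume_integral /Rintegral integral_mkcond.
have [M hM] := extends_bounded bO eF.
have FM p : `|F (point p)| <= `|M|.
  have [/rO Op|/F_outcube ->] := pselect (cube a r (point p)).
    by apply: le_trans (hM _ Op) _; exact: ler_norm.
  by rewrite normr0.
have fin (b : R) : (@lebesgue_measure R `[(b - r)%R, (b + r)%R] < +oo)%E.
  by rewrite lebesgue_measure_itv/=; case: ifPn; rewrite ?ltry// -EFinD ltry.
have outF p : ~ ((`[a 0 o0 - r, a 0 o0 + r] `*` `[a 0 o1 - r, a 0 o1 + r])
                 `*` `[a 0 o2 - r, a 0 o2 + r]) p -> F (point p) = 0.
  by rewrite -point_cube; exact: F_outcube.
rewrite (_ : (fun p => _) \_ _ = fun p => (F (point p))%:E); last first.
  apply/funext => p; rewrite patchE; case: ifPn => // /negP np.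
  by rewrite F_outcube// => /rO Op; apply: np; exact/mem_set.
(* The integrand is supported in the cube, so the integral can be taken over
   the whole space. *)
rewrite (_ : integral _ _ _ = 0%E)//.
have line (q : R -> R * R * R) x : (forall t, point (q t) = x + t *: delta_mx 0 i) ->
    x 0 i = 0 -> (\int[@lebesgue_measure R]_t (F (point (q t)))%:E = 0)%E.
  by move=> qE xi; rewrite -[RHS](line_zero xi); apply: eq_integral => t _; rewrite qE.
case: (i) line => -[|[|[|//]]] /= i3 line.
- apply: (fubini_eq0_x (fin _) (fin _) (fin _) mF FM outF) => y z.
  apply: (line _ (point (0, y, z))); last by rewrite mxE.
  move=> t; apply/rowP; apply: forall_ord3; rewrite !mxE/=; ring.
- apply: (fubini_eq0_y (fin _) (fin _) (fin _) mF FM outF) => y z.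
  apply: (line _ (point (y, 0, z))); last by rewrite mxE.
  move=> t; apply/rowP; apply: forall_ord3; rewrite !mxE/=; ring.
- apply: (fubini_eq0_z (fin _) (fin _) (fin _) mF FM outF) => q.
  apply: (line _ (point (q, 0))); last by rewrite mxE.
  move=> t; apply/rowP; apply: forall_ord3; rewrite !mxE/=; ring.
Qed.

End ByParts.

End Variational.

(** * Tensors arranged as vectors *)

Section Voigt.
Set Implicit Arguments.
Unset Strict Implicit.
Variable R : realType.
Local Notation E := 'rV[R]_3.
Implicit Types (A B S : 'M[R]_3) (x : E).

(** The arrangement in 9 components runs over every pair of indices once. *)
Lemma sum_vec (V : nmodType) (F : 'I_3 -> 'I_3 -> V) :
  \sum_(a < 9) F (row_of a) (col_of a) = \sum_i \sum_j F i j.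
Proof.
have i0 : inord 0 = o0 by apply: val_inj; rewrite /= inordK.
have i1 : inord 1 = o1 by apply: val_inj; rewrite /= inordK.
have i2 : inord 2 = o2 by apply: val_inj; rewrite /= inordK.
rewrite exchange_big/= !sum_ord3 !big_ord_recl big_ord0 addr0.
rewrite /row_of /col_of/= /bump/= !i0 !i1 !i2.
by rewrite -!addrA.
Qed.

Lemma vecD A B : vec (A + B) = vec A + vec B.
Proof. by apply/matrixP => a b; rewrite !mxE. Qed.

Lemma vecZ (c : R) A : vec (c *: A) = c *: vec A.
Proof. by apply/matrixP => a b; rewrite !mxE. Qed.

Lemma colT_mulmx n (p q : 'cV[R]_n) : (p^T *m q) 0 0 = \sum_j p j 0 * q j 0.
Proof. by rewrite mxE; apply: eq_bigr => j _; rewrite mxE. Qed.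

Lemma moment_mx_vec A : moment_mx R *m vec A =
  \col_k [:: A o2 o1 - A o1 o2; A o2 o0 - A o0 o2; A o1 o0 - A o0 o1]`_k.
Proof.
have i0 : inord 0 = o0 by apply: val_inj; rewrite /= inordK.
have i1 : inord 1 = o1 by apply: val_inj; rewrite /= inordK.
have i2 : inord 2 = o2 by apply: val_inj; rewrite /= inordK.
apply/colP; apply: forall_ord3; rewrite !mxE !big_ord_recl big_ord0 !mxE/=
  /row_of /col_of/= /bump/= ?i0 ?i1 ?i2; ring.
Qed.

(** The moment matrix annihilates symmetric tensors. *)
Lemma moment_mx_vec_sym A : A^T = A -> moment_mx R *m vec A = 0.
Proof.
move=> symA; have sA i j : A i j = A j i by rewrite -[in LHS]symA mxE.
rewrite moment_mx_vec (sA o2 o1) (sA o2 o0) (sA o1 o0) !subrr.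
by apply/colP; apply: forall_ord3; rewrite !mxE.
Qed.

Lemma moment_mx_vec_eq0 A : moment_mx R *m vec A = 0 -> forall i j, A i j = A j i.
Proof.
rewrite moment_mx_vec => /colP h.
have := h o0; rewrite !mxE/= => /subr0_eq h0.
have := h o1; rewrite !mxE/= => /subr0_eq h1.
have := h o2; rewrite !mxE/= => /subr0_eq h2.
by apply: forall_ord3; apply: forall_ord3.
Qed.

(** The bilinear form A : C : B of the compliance tensor at x. *)
Definition energy (C : E -> 'I_3 -> 'I_3 -> 'I_3 -> 'I_3 -> R) x A B : R :=
  ((vec A)^T *m compliance_mx C x *m vec B) 0 0.

Lemma energyE C x A B : energy C x A B =
  \sum_i \sum_j A i j * \sum_k \sum_l C x i j k l * B k l.
Proof.
rewrite /energy -mulmxA colT_mulmx.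
rewrite -(sum_vec (fun i j => A i j * \sum_k \sum_l C x i j k l * B k l)).
apply: eq_bigr => a _; rewrite mxE; congr (_ * _).
rewrite mxE -(sum_vec (fun k l => C x (row_of a) (col_of a) k l * B k l)).
by apply: eq_bigr => b _; rewrite !mxE.
Qed.

Lemma energy_sym C x A B :
  (forall i j k l, C x i j k l = C x k l i j) -> energy C x A B = energy C x B A.
Proof.
move=> symC.
have CT : (compliance_mx C x)^T = compliance_mx C x.
  by apply/matrixP => a b; rewrite !mxE symC.
rewrite /energy -[in LHS](trmxK (_ *m vec B)) [LHS]mxE !trmx_mul trmxK CT.
by rewrite mulmxA.
Qed.

Lemma energy_quadratic C x A S (t : R) :
  (forall i j k l, C x i j k l = C x k l i j) ->
  energy C x (A + t *: S) (A + t *: S) =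
  energy C x A A + t * (2 * energy C x S A) + t ^+ 2 * energy C x S S.
Proof.
move=> symC.
have -> : energy C x (A + t *: S) (A + t *: S) =
    energy C x A A + t * energy C x A S + t * energy C x S A +
    t ^+ 2 * energy C x S S.
  have trD : (vec A + t *: vec S)^T = (vec A)^T + t *: (vec S)^T.
    by apply/matrixP => a b; rewrite !mxE.
  rewrite /energy vecD vecZ trD !(mulmxDl, mulmxDr).
  by rewrite -!(scalemxAl, scalemxAr) !mxE; ring.
by rewrite (energy_sym A S symC); ring.
Qed.

Lemma energyZl C x (c : R) A B : energy C x (c *: A) B = c * energy C x A B.
Proof. by rewrite /energy vecZ [(_ *: _)^T]linearZ/= -!scalemxAl mxE. Qed.

Lemma energyZr C x (c : R) A B : energy C x A (c *: B) = c * energy C x A B.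
Proof. by rewrite /energy vecZ -scalemxAr mxE. Qed.

(** The symmetric tensor with unit entries at (i, j) and (j, i), and with the
    entry 2 if i = j. *)
Definition sym_unit i j : 'M[R]_3 := delta_mx i j + delta_mx j i.

Lemma tr_sym_unit i j : (sym_unit i j)^T = sym_unit i j.
Proof. by rewrite /sym_unit linearD/= !trmx_delta addrC. Qed.

Lemma sum_delta (F : 'I_3 -> 'I_3 -> R) i j :
  \sum_a \sum_b (delta_mx i j : 'M[R]_3) a b * F a b = F i j.
Proof.
rewrite (bigD1 i)//= (bigD1 j)//= !big1 ?addr0.
- by rewrite mxE !eqxx mul1r.
- move=> a ai; apply: big1 => b _; by rewrite mxE (negbTE ai) mul0r.
- by move=> b bj; rewrite mxE (negbTE bj) andbF mul0r.
Qed.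

Lemma sum_sym_unit (F : 'I_3 -> 'I_3 -> R) i j :
  \sum_a \sum_b sym_unit i j a b * F a b = F i j + F j i.
Proof.
rewrite -(sum_delta F i j) -(sum_delta F j i) -big_split/=.
apply: eq_bigr => a _; rewrite -big_split/=; apply: eq_bigr => b _.
by rewrite mxE mulrDl.
Qed.

End Voigt.

(** * The three variations of the Lagrangian *)

Section Stationary.
Set Implicit Arguments.
Unset Strict Implicit.
Variable R : realType.
Local Notation E := 'rV[R]_3.

(** The coefficient of t in a quadratic polynomial that is stationary at 0 is 0. *)
Lemma stationary_quadratic (L : R -> R) (A B C : R) :
  (forall t, L t = A + t * B + t ^+ 2 * C) ->
  is_derive (0 : R) (1 : R) L 0 -> B = 0.
Proof.
move=> /funext -> [_ <-].
by have [_ ->] := is_derive_quadratic A B C.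
Qed.

Lemma volume_integral_sum (Omega : set E) n (F : 'I_n -> E -> R) :
  open Omega -> bounded_set Omega -> (forall i, extends_C0 Omega (F i)) ->
  volume_integral Omega (fun x => \sum_i F i x) =
  \sum_i volume_integral Omega (F i).
Proof.
move=> oO bO; elim: n F => [|n ih] F eF.
  rewrite big_ord0 (@eq_volume_integral _ _ _ (fun x => 0 * 0)).
    by rewrite volume_integralZ ?mul0r//; exact: extends_cst.
  by move=> x _; rewrite big_ord0 mul0r.
rewrite big_ord_recl -ih// -volume_integralD//; last exact: extends_sum.
by apply: eq_volume_integral => x _; rewrite big_ord_recl.
Qed.

Lemma is_derive_bumpM (a : E) r i (c : R) x :
  is_derive x (delta_mx 0 i) (fun y => bump a r y * c) (dbump a r i x * c).
Proof.
have -> : (fun y => bump a r y * c) = c \*: bump a r.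
  by apply/funext => y; rewrite /= mulrC.
apply: is_derive_eq; first exact: (is_deriveZ c (is_derive_bump a r i x)).
by rewrite mulrC.
Qed.

Lemma bumpM_C1 Omega (a : E) r (c : R) : C1_closure Omega (fun x => bump a r x * c).
Proof.
have cM (g : E -> R) : continuous g -> C0_closure Omega (fun x => g x * c).
  move=> cg; apply: continuous_subspaceT => x.
  by apply: (@cvgM _ _ (nbhs x)); [exact: cg|exact: cvg_cst].
split.
- exact/cM/continuous_bump.
- by move=> i x _; have [] := is_derive_bumpM a r i c x.
- move=> i; exists (fun x => dbump a r i x * c); first exact/cM/continuous_dbump.
  by move=> x _; have [_ <-] := is_derive_bumpM a r i c x.
Qed.

Variables (Omega Gu Gt : set E) (C : E -> 'I_3 -> 'I_3 -> 'I_3 -> 'I_3 -> R)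
  (f ubar : E -> 'cV[R]_3) (s : E -> 'M[R]_3) (u w : E -> 'cV[R]_3).
Hypotheses (oO : open Omega) (bO : bounded_set Omega).
Hypothesis hs : stress_space Omega s.
Hypothesis hu : displacement_space Omega u.
Hypothesis hw : rotation_space Omega w.
Hypothesis hf : forall j, C0_closure Omega (fun x => f x j 0).
Hypothesis hC : elastic_compliance Omega C.
Let L := Lagrangian Omega Gu C f ubar.

Let es i j : extends_C0 Omega (fun x => s x i j).
Proof. by have [c0 _ _] := hs i j; exact: C0_extends. Qed.

Let eu j : extends_C0 Omega (fun x => u x j 0).
Proof. by have [c0 _ _] := hu j; exact: C0_extends. Qed.

Let epdu i j : extends_C0 Omega (pd i (fun x => u x j 0)).
Proof. by have [_ _] := hu j; exact. Qed.

Let ebump a r : extends_C0 Omega (bump a r).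
Proof. exact/continuous_extends/continuous_bump. Qed.

Let edbump a r i : extends_C0 Omega (dbump a r i).
Proof. exact/continuous_extends/continuous_dbump. Qed.

(** The left-hand side of the equation of equilibrium of forces. *)
Definition force_residual j x : R := \sum_i pd i (fun y => s y i j) x + f x j 0.

Let eforce j : extends_C0 Omega (force_residual j).
Proof.
apply: extendsD; last exact: C0_extends.
by apply: extends_sum => i; have [_ _] := hs i j; exact.
Qed.

Let force_dot (v : 'cV[R]_3) x :
  (v^T *m (divergence s x + f x)) 0 0 = \sum_j v j 0 * force_residual j x.
Proof. by rewrite colT_mulmx; apply: eq_bigr => j _; rewrite !mxE. Qed.

(** Vary u by a test function times a unit vector: the Lagrangian is affine in u. *)
Lemma force_equilibrium :
  (forall du, displacement_space Omega du ->
    is_derive (0 : R) (1 : R) (fun t : R => L s (u + t *: du) w) 0) ->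
  forall x, Omega x -> forall j, force_residual j x = 0.
Proof.
move=> stat x Ox j.
apply: (bump_test_eq0 oO bO (eforce j) _ Ox) => a r r0 rO.
pose du y : 'cV[R]_3 := bump a r y *: delta_mx j 0.
have hdu : displacement_space Omega du.
  by move=> k; rewrite /du; under eq_fun do rewrite !mxE; exact: bumpM_C1.
apply: (@stationary_quadratic _ (L s u w) _ 0 _ (stat du hdu)) => t.
rewrite mulr0 addr0 /L /Lagrangian [RHS]addrAC; congr (_ - _).
rewrite -[RHS]addrA; congr (_ + _).
rewrite -volume_integralZ//; last exact: extendsM.
rewrite -volume_integralD//; last 2 first.
- rewrite (_ : (fun _ => _) = fun y => \sum_k u y k 0 * force_residual k y).
    by apply: extends_sum => k; exact: extendsM.
  by apply/funext => y; exact: force_dot.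
- by apply: extendsM; [exact: extends_cst|exact: extendsM].
apply: eq_volume_integral => y _; rewrite !force_dot.
have -> : bump a r y * force_residual j y = \sum_k du y k 0 * force_residual k y.
  rewrite (bigD1 j)//= big1 ?addr0; first by rewrite !mxE !eqxx mulr1.
  by move=> k kj; rewrite !mxE (negbTE kj) mulr0 mul0r.
rewrite mulr_sumr -big_split/=; apply: eq_bigr => k _.
by rewrite !fctE !mxE; ring.
Qed.

(** The three components of R s, each the difference of two opposite shear
    stresses. *)
Let moment_residual k x : R := (moment_mx R *m vec (s x)) k 0.

Let emoment k : extends_C0 Omega (moment_residual k).
Proof.
rewrite /moment_residual; under eq_fun do rewrite mxE.
apply: extends_sum => a; apply: extendsM; first exact: extends_cst.
by under eq_fun do rewrite mxE; exact: es.
Qed.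

(** Vary w by a test function times a unit vector: the Lagrangian is affine in w. *)
Lemma moment_equilibrium :
  (forall dw, rotation_space Omega dw ->
    is_derive (0 : R) (1 : R) (fun t : R => L s u (w + t *: dw)) 0) ->
  forall x, Omega x -> forall i j, s x i j = s x j i.
Proof.
move=> stat x Ox; apply: moment_mx_vec_eq0; apply/colP => k; rewrite [RHS]mxE.
apply: (bump_test_eq0 oO bO (emoment k) _ Ox) => a r r0 rO.
pose dw y : 'cV[R]_3 := bump a r y *: delta_mx k 0.
have hdw : rotation_space Omega dw.
  move=> l; rewrite /dw; under eq_fun do rewrite !mxE.
  by have [] := @bumpM_C1 Omega a r ((l == k) && true)%:R.
apply: oppr_inj; rewrite oppr0.
apply: (@stationary_quadratic _ (L s u w) _ 0 _ (stat dw hdw)) => t.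
rewrite mulr0 addr0 /L /Lagrangian mulrN -[RHS]addrA -opprD; congr (_ - _).
rewrite -volume_integralZ//; last exact: extendsM.
have dotE (v : 'cV[R]_3) y : (v^T *m moment_mx R *m vec (s y)) 0 0 =
    \sum_l v l 0 * moment_residual l y by rewrite -mulmxA colT_mulmx.
rewrite -volume_integralD//; last 2 first.
- rewrite (_ : (fun _ => _) = fun y => \sum_l w y l 0 * moment_residual l y).
    by apply: extends_sum => l; apply: extendsM => //; exact: C0_extends.
  by apply/funext => y; exact: dotE.
- by apply: extendsM; [exact: extends_cst|exact: extendsM].
apply: eq_volume_integral => y _; rewrite !dotE.
have -> : bump a r y * moment_residual k y =
    \sum_l dw y l 0 * moment_residual l y.
  rewrite (bigD1 k)//= big1 ?addr0; first by rewrite !mxE !eqxx mulr1.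
  by move=> l lk; rewrite !mxE (negbTE lk) mulr0 mul0r.
rewrite mulr_sumr -big_split/=; apply: eq_bigr => l _.
by rewrite !fctE !mxE; ring.
Qed.

Let eenergy (A B : E -> 'M[R]_3) :
  (forall i j, extends_C0 Omega (fun x => A x i j)) ->
  (forall i j, extends_C0 Omega (fun x => B x i j)) ->
  extends_C0 Omega (fun x => energy C x (A x) (B x)).
Proof.
move=> eA eB; under eq_fun do rewrite energyE.
apply: extends_sum => i; apply: extends_sum => j; apply: extendsM => //.
apply: extends_sum => k; apply: extends_sum => l; apply: extendsM => //.
by have [cC _ _] := hC; exact: C0_extends.
Qed.

(** Vary s by a test function times a symmetric tensor S.  The rotation drops out
    because R S = 0, and the boundary term because the test function vanishes
    there; integrating by parts the term with u leaves the symmetric part of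
    the gradient of u, which is the strain. *)
Lemma constitutive : Gu `<=` boundary Omega -> Gt `<=` boundary Omega ->
  (forall ds, stress_space Omega ds -> has_traction Omega Gt ds (fun=> 0) ->
    is_derive (0 : R) (1 : R) (fun t : R => L (s + t *: ds) u w) 0) ->
  forall x, Omega x -> forall i j,
    strain u x i j = \sum_k \sum_l C x i j k l * s x k l.
Proof.
move=> GuO GtO stat x Ox i j.
have [_ symC minC] := hC.
have symCO y : Omega y -> forall i j k l, C y i j k l = C y k l i j.
  by move=> Oy; apply: symC; exact: subset_closure.
pose S := sym_unit R i j.
(* G x is twice the difference of C s and the strain at (i, j). *)
pose G y := energy C y S (s y) - \sum_a \sum_b S a b * pd a (fun y => u y b 0) y.
have eES : extends_C0 Omega (fun y => energy C y S (s y)).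
  by apply: eenergy => // a b; exact: extends_cst.
have eG : extends_C0 Omega G.
  apply: extendsD => //; apply: extendsN.
  apply: extends_sum => a; apply: extends_sum => b; apply: extendsM => //.
  exact: extends_cst.
have : G x = 0.
  apply: (bump_test_eq0 oO bO eG _ Ox) => a r r0 rO.
  pose ds y : 'M[R]_3 := bump a r y *: S.
  have bump0 y : ~ Omega y -> bump a r y = 0.
    move=> nOy; apply: contrapT => /eqP b0; apply: nOy; apply: rO => k.
    have : y 0 k \in `]a 0 k - r, a 0 k + r[.
      by apply: contraNT b0 => out; rewrite (bump_eq0 r0 out).
    by rewrite !in_itv/= => /andP[? ?]; apply/andP; split; exact: ltW.
  have boundary_out y : boundary Omega y -> ~ Omega y.
    by move=> [_]; rewrite (interior_id _).1.
  have hds : stress_space Omega ds.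
    by move=> k l; rewrite /ds; under eq_fun do rewrite mxE; exact: bumpM_C1.
  have hdst : has_traction Omega Gt ds (fun=> 0).
    move=> y n /GtO/boundary_out/bump0 b0 _; apply/colP => k; rewrite !mxE.
    by apply: big1 => l _; rewrite /ds b0 scale0r mxE mul0r.
  (* W is the product of u and the divergence of the variation. *)
  pose W y := \sum_k \sum_l S k l * (u y l 0 * dbump a r k y).
  have eW : extends_C0 Omega W.
    apply: extends_sum => k; apply: extends_sum => l; apply: extendsM.
      exact: extends_cst.
    exact: extendsM.
  have eBE : extends_C0 Omega (fun y => bump a r y * energy C y S (s y)).
    exact: extendsM.
  have var0 : volume_integral Omega (fun y => bump a r y * energy C y S (s y))
              + volume_integral Omega W = 0.
    (* Q is the quadratic term of the energy. *)
    pose Q := volume_integral Omega (fun y => bump a r y ^+ 2 * energy C y S S).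
    apply: (@stationary_quadratic _ (L s u w) _ (2^-1 * Q) _ (stat ds hds hdst)).
    move=> t; rewrite /L /Lagrangian.
    have -> : volume_integral Omega (fun y =>
        ((vec ((s + t *: ds) y))^T *m compliance_mx C y *m vec ((s + t *: ds) y)) 0 0)
      = volume_integral Omega (fun y =>
        ((vec (s y))^T *m compliance_mx C y *m vec (s y)) 0 0) +
        t * (2 * volume_integral Omega (fun y => bump a r y * energy C y S (s y)))
        + t ^+ 2 * Q.
      have e1 : extends_C0 Omega (fun y => energy C y (s y) (s y)) by exact: eenergy.
      have e2 : extends_C0 Omega (fun y => bump a r y ^+ 2 * energy C y S S).
        apply: extendsM; last by apply: eenergy => k l; exact: extends_cst.
        by under eq_fun do rewrite expr2; exact: extendsM.
      have eZ (c : R) g : extends_C0 Omega g -> extends_C0 Omega (fun y => c * g y).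
        by move=> eg; apply: extendsM => //; exact: extends_cst.
      rewrite /Q -!volume_integralZ//; do ?[exact: eZ].
      rewrite -!volume_integralD//; do ?[exact: eZ|exact/eZ/eZ].
      - apply: eq_volume_integral => y Oy.
        rewrite -[LHS]/(energy C y _ _) !fctE energy_quadratic; last exact: symCO.
        by rewrite /ds !(energyZl, energyZr) -[(_ *m _) 0 0]/(energy C y _ _); ring.
      - by apply: extendsD => //; exact/eZ/eZ.
    have -> : surface_integral Gu (fun y =>
        ((traction (s + t *: ds) y (normal Omega y))^T *m ubar y) 0 0) =
      surface_integral Gu (fun y => ((traction s y (normal Omega y))^T *m ubar y) 0 0).
      apply: eq_Rintegral => y /set_mem/GuO/boundary_out/bump0 b0.
      have sy : (s + t *: ds) y = s y.
        by apply/matrixP => k l; rewrite !fctE !mxE b0 mul0r mulr0 addr0.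
      by rewrite /traction sy.
    have -> : volume_integral Omega (fun y =>
        ((w y)^T *m moment_mx R *m vec ((s + t *: ds) y)) 0 0) =
      volume_integral Omega (fun y => ((w y)^T *m moment_mx R *m vec (s y)) 0 0).
      apply: eq_volume_integral => y _; rewrite -!mulmxA; congr ((_ *m _) 0 0).
      rewrite !fctE vecD /ds !vecZ mulmxDr -!scalemxAr.
      by rewrite (moment_mx_vec_sym (tr_sym_unit R i j)) !scaler0 addr0.
    have -> : volume_integral Omega (fun y =>
        ((u y)^T *m (divergence (s + t *: ds) y + f y)) 0 0) =
      volume_integral Omega (fun y => ((u y)^T *m (divergence s y + f y)) 0 0) +
      t * volume_integral Omega W.
      rewrite -volume_integralZ// -volume_integralD//; last 2 first.
      - rewrite (_ : (fun _ => _) = fun y => \sum_k u y k 0 * force_residual k y).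
          by apply: extends_sum => k; exact: extendsM.
        by apply/funext => y; exact: force_dot.
      - by apply: extendsM => //; exact: extends_cst.
      apply: eq_volume_integral => y Oy; rewrite force_dot colT_mulmx.
      rewrite /W exchange_big/= mulr_sumr -big_split/=; apply: eq_bigr => l _.
      rewrite !mxE /force_residual.
      have pdE k : pd k (fun z => (s + t *: ds) z k l) y =
          pd k (fun z => s z k l) y + t * (dbump a r k y * S k l).
        rewrite /pd; have [_ ds1 _] := hs k l.
        have -> : (fun z => (s + t *: ds) z k l) =
            (fun z => s z k l) + t \*: (fun z => bump a r z * S k l).
          by apply/funext => z; rewrite !fctE !mxE.
        have := is_deriveD (derivableP (ds1 k _ Oy))
          (is_deriveZ t (is_derive_bumpM a r k (S k l) y)).
        by move=> [_ ->].
      rewrite (eq_bigr _ (fun k _ => pdE k)).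
      rewrite big_split/= -mulr_sumr !mulrDr !mulr_sumr.
      rewrite addrAC; congr (_ + _); apply: eq_bigr => k _; ring.
    by field.
  have byparts k l : volume_integral Omega (fun y =>
      u y l 0 * dbump a r k y + bump a r y * pd k (fun y => u y l 0) y) = 0.
    exact: (volume_integral_by_parts_bump k oO bO (hu l) r0 rO).
  have eBP k l : extends_C0 Omega (fun y =>
      u y l 0 * dbump a r k y + bump a r y * pd k (fun y => u y l 0) y).
    by apply: extendsD; exact: extendsM.
  have eSBP k l : extends_C0 Omega (fun y => S k l *
      (u y l 0 * dbump a r k y + bump a r y * pd k (fun y => u y l 0) y)).
    by apply: extendsM => //; exact: extends_cst.
  (* V integrates to 0, so that subtracting it moves the derivatives from the
     test function to u. *)
  pose V y := \sum_k \sum_l S k l *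
    (u y l 0 * dbump a r k y + bump a r y * pd k (fun y => u y l 0) y).
  have eV : extends_C0 Omega V.
    by apply: extends_sum => k; apply: extends_sum => l.
  have V0 : volume_integral Omega V = 0.
    rewrite volume_integral_sum// => [|k]; last exact: extends_sum.
    apply: big1 => k _; rewrite volume_integral_sum//.
    by apply: big1 => l _; rewrite volume_integralZ// byparts mulr0.
  have -> : volume_integral Omega (fun y => bump a r y * G y) =
      volume_integral Omega (fun y =>
        (bump a r y * energy C y S (s y) + W y) + -1 * V y).
    apply: eq_volume_integral => y _; rewrite /G /W /V mulrBr mulN1r -addrA.
    congr (_ + _); rewrite mulr_sumr -sumrN -sumrN -big_split/=; apply: eq_bigr => k _.
    rewrite mulr_sumr -sumrN -sumrN -big_split/=; apply: eq_bigr => l _; ring.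
  rewrite volume_integralD//; last 2 first.
  - exact: extendsD.
  - by apply: extendsM => //; exact: extends_cst.
  by rewrite volume_integralD// volume_integralZ// V0 mulr0 addr0.
have cO : closure Omega x by exact: subset_closure.
(* The entries (i, j) and (j, i) contribute equally, by the minor symmetry
   of C. *)
rewrite /G energyE sum_sym_unit (sum_sym_unit (fun a b => pd a (fun y => u y b 0) x)).
have -> : \sum_k \sum_l C x j i k l * s x k l = \sum_k \sum_l C x i j k l * s x k l.
  by apply: eq_bigr => k _; apply: eq_bigr => l _; rewrite minC.
by rewrite mxE => GE; lra.
Qed.

End Stationary.

Theorem theorem1 (R : realType) (Omega Gu Gt : set 'rV[R]_3)
    (C : 'rV[R]_3 -> 'I_3 -> 'I_3 -> 'I_3 -> 'I_3 -> R)
    (f ubar tbar : 'rV[R]_3 -> 'cV[R]_3)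
    (s : 'rV[R]_3 -> 'M[R]_3) (u w : 'rV[R]_3 -> 'cV[R]_3)
    (hOmega : domain_with_normal Omega)
    (hGamma : boundary Omega = Gu `|` Gt)
    (hdisj : Gu `&` Gt = set0)
    (hGu : (@hausdorff2 R).-cara.-measurable Gu)
    (hubar : forall j : 'I_3,
        (@surface_measure R).-integrable Gu (fun x => (ubar x j 0)%:E))
    (hf : forall j : 'I_3, C0_closure Omega (fun x => f x j 0))
    (hC : elastic_compliance Omega C)
    (hstat : stationary_point Omega Gu Gt C f ubar tbar s u w) :
  [/\ forall x, Omega x -> forall j : 'I_3,
        \sum_(i < 3) pd i (fun y => s y i j) x + f x j 0 = 0,
      forall x, Omega x -> forall i j : 'I_3, s x i j - s x j i = 0,
      forall x n, Gt x -> outward_normal Omega x n -> forall j : 'I_3,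
        \sum_(i < 3) s x i j * n 0 i = tbar x j 0 &
      forall x, Omega x -> forall i j : 'I_3,
        strain u x i j = \sum_(k < 3) \sum_(l < 3) C x i j k l * s x k l].
Proof.
have [[oO _ _ bO] _ _] := hOmega.
have [[hs ht hu hw] stat_s stat_u stat_w] := hstat.
split.
- exact: (force_equilibrium oO bO hs hu hf stat_u).
- by move=> x Ox i j; rewrite (moment_equilibrium oO bO hs hw stat_w Ox i j) subrr.
- move=> x n Gtx nx j; have /colP/(_ j) := ht x n Gtx nx.
  by rewrite mxE.
- apply: (constitutive oO bO hs hu hf hC _ _ stat_s).
  + by rewrite hGamma; exact: subsetUl.
  + by rewrite hGamma; exact: subsetUr.
Qed.
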